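(* The set of simple $-\beta$ numbers, i.e. the set of real numbers $\beta>1$ for which the $(-\beta)$-expansion $\pi_{-\beta}(1)$ of $1$ is a periodic sequence, is dense in the interval $(1,+\infty)$.
   Context: For a real number $\beta>1$, the negative $\beta$-transformation is $T_{-\beta}:(0,1]\to(0,1]$, $T_{-\beta}(x)=-\beta x+\lfloor \beta x\rfloor+1$. The $(-\beta)$-expansion of $x\in(0,1]$ is the sequence $\pi_{-\beta}(x)=(d_n)_{n\ge1}$ with $d_n=\lfloor \beta T_{-\beta}^{n-1}(x)\rfloor+1\in\{1,\dots,\lfloor\beta\rfloor+1\}$, so that $x=\sum_{n\ge1}\frac{-d_n}{(-\beta)^n}$. A sequence $(d_n)_{n\ge 1}$ is periodic if it is purely periodic, i.e. of the form $(d_1\cdots d_p)^\infty$ (infinite repetition of a finite word) for some $p\ge1$. A number $\beta>1$ is called a simple $-\beta$ number if $\pi_{-\beta}(1)$ is periodic. *)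

(* Defs.v *)
From mathcomp Require Import all_boot all_order all_algebra.
From mathcomp Require Import all_classical all_reals all_analysis.
Import Order.TTheory GRing.Theory Num.Theory numFieldNormedType.Exports.
Set Implicit Arguments.
Unset Strict Implicit.
Unset Printing Implicit Defensive.
Local Open Scope classical_set_scope.
Local Open Scope ring_scope.

(* Only the restriction to ]0, 1] matters, which neg_beta_map preserves
   (see neg_beta_map_itv). *)
Definition neg_beta_map (R : realType) (beta x : R) : R :=
  - beta * x + (Num.floor (beta * x))%:~R + 1.

Lemma neg_beta_map_itv (R : realType) (beta x : R) :
  neg_beta_map beta x \in `]0, 1].
Proof.
rewrite in_itv /= /neg_beta_map mulNr.
have /andP[h1 h2] := floor_itv (beta * x).
move: h2; rewrite intrD => h2.
by rewrite -addrA addrC subr_gt0 h2 /= lerBlDr addrC lerD2l.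
Qed.

(* Sequences are indexed from 0: neg_beta_expansion beta x n is the digit
   d_(n+1) of x. *)
Definition neg_beta_expansion (R : realType) (beta x : R) (n : nat) : int :=
  Num.floor (beta * iter n (neg_beta_map beta) x) + 1.

(* d is the infinite repetition of the finite word d 0, ..., d (p - 1). *)
Definition purely_periodic (A : Type) (d : nat -> A) : Prop :=
  exists2 p : nat, (0 < p)%N & forall n : nat, d n = d (n %% p)%N.

Definition simple_neg_beta (R : realType) : set R :=
  [set beta : R | 1 < beta /\ purely_periodic (neg_beta_expansion beta 1)].

(* Main.v *)
Require Import Defs.
From mathcomp Require Import all_boot all_order all_algebra.
From mathcomp Require Import all_classical all_reals all_analysis.
From mathcomp Require Import ring lra.
Import Order.TTheory GRing.Theory Num.Theory numFieldNormedType.Exports.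
Local Open Scope classical_set_scope.
Local Open Scope ring_scope.

(** If no [beta] in an interval [I] is simple, the points [T^n 1] never return
    to [1], so by the intermediate value theorem every digit [d_n] of [1] is
    constant on [I].  The power series [1 + \sum_(n >= 1) d_n z^n] then has
    bounded coefficients and vanishes at [z = -1/beta] for every [beta] in [I].
    Dividing out infinitely many of these zeros by Blaschke factors normalised
    to be [1] at the origin keeps the constant term [1], while the l^2 norm
    (after a slight rescaling of [z]) tends to [0]: a contradiction. *)

(** Coefficients of [f(z) / (1 + b z)]. *)
Fixpoint quot (R : realType) (b : R) (f : nat -> R) (n : nat) : R :=
  if n is n'.+1 then f n'.+1 - b * quot R b f n' else f 0%N.
Arguments quot {R}.

(** Coefficients of [f(z) (1 + z / b) / (1 + b z)]. *)
Definition blaschke (R : realType) (b : R) (f : nat -> R) (n : nat) : R :=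
  if n is n'.+1 then quot b f n'.+1 + quot b f n' / b else f 0%N.
Arguments blaschke {R}.

(** With [q = quot b f], the coefficients are [q i + b * q (i-1)] for [f] and [q i + q (i-1) / b]
    for [blaschke b f], so the difference of squares telescopes. This truncates the fact that the
    Blaschke factor has modulus [1 / b] on the unit circle. *)
Lemma sum_sqr_blaschke (R : realType) (b : R) (f : nat -> R) (n : nat) :
  b != 0 ->
  b ^+ 2 * (\sum_(i < n.+1) blaschke b f i ^+ 2) =
  \sum_(i < n.+1) f i ^+ 2 + (b ^+ 2 - 1) * quot b f n ^+ 2.
Proof.
move=> b0; elim: n => [|n IHn]; first by rewrite !big_ord1 /=; ring.
rewrite big_ord_recr mulrDr IHn [in RHS]big_ord_recr /=.
by field.
Qed.

(** Partial fractions of [(1 + z/a) / ((1 + a z) (1 + b z))]; hence dividing out the zero [- 1 / a]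
    keeps the zero [- 1 / b]. *)
Lemma quot_blaschke (R : realType) (a b : R) (f : nat -> R) (n : nat) :
  a != 0 -> a != b ->
  quot b (blaschke a f) n =
  (a - a^-1) / (a - b) * quot a f n + (b - a^-1) / (b - a) * quot b f n.
Proof.
move=> a0; rewrite -subr_eq0 => ab.
have ba : b - a != 0 by rewrite -opprB oppr_eq0.
elim: n => [|n IHn] /=; first by field; rewrite a0 ab ba.
by rewrite IHn; field; rewrite a0 ab ba.
Qed.

Lemma sum_sqr_blaschke_le (R : realType) (b A : R) (f : nat -> R) (n : nat) :
  1 < b -> (forall n, \sum_(i < n) f i ^+ 2 <= A) ->
  quot b f @ \oo --> (0 : R) ->
  \sum_(i < n) blaschke b f i ^+ 2 <= A / b ^+ 2.
Proof.
move=> b1 fA qf.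
have b0 : 0 < b by lra.
rewrite ler_pdivlMr ?exprn_gt0// mulrC.
have cv : (fun k => A + (b ^+ 2 - 1) * quot b f k ^+ 2) @ \oo --> A.
  rewrite -[X in _ --> X]addr0 -(mulr0 (b ^+ 2 - 1)) -(mulr0 0).
  apply: cvgD; first exact: cvg_cst.
  by apply: cvgM; [exact: cvg_cst|exact: cvgM].
rewrite -(cvg_lim _ cv)//; apply: limr_ge; first by apply/cvg_ex; exists A.
near=> k.
(* Partial sums of squares increase, so the identity may be used at a large [k], where its boundary
   term is negligible. *)
have nk : (n <= k.+1)%N by apply: leqW; near: k; exact: nbhs_infty_ge.
apply: (@le_trans _ _ (b ^+ 2 * \sum_(i < k.+1) blaschke b f i ^+ 2)).
  rewrite ler_pM2l ?exprn_gt0//.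
  rewrite -(big_mkord xpredT (fun i => blaschke b f i ^+ 2)).
  rewrite -(big_mkord xpredT (fun i => blaschke b f i ^+ 2)).
  rewrite (big_cat_nat _ nk)//= lerDl.
  by apply: sumr_ge0 => i _; exact: sqr_ge0.
by rewrite sum_sqr_blaschke ?gt_eqF// lerD2r.
Unshelve. all: by end_near. Qed.

(** The last hypothesis says that [f] vanishes at each [- 1 / b i]. *)
Lemma coef0_bound (R : realType) (m A : R) (b f : nat -> R) (k : nat) :
  1 < m -> injective b -> (forall i, m <= b i) ->
  (forall n, \sum_(i < n) f i ^+ 2 <= A) ->
  (forall i, quot (b i) f @ \oo --> (0 : R)) ->
  f 0%N ^+ 2 * m ^+ k <= A.
Proof.
move=> m1; elim: k A b f => [|k IHk] A b f binj mb fA qf.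
  by have := fA 1%N; rewrite big_ord1 expr0 mulr1.
have b1 : 1 < b 0%N by apply: lt_le_trans (mb 0%N).
have b0 : 0 < b 0%N by lra.
(* Dividing out the zero of [b 0] keeps the constant term and improves the bound by
   [b 0 ^+ 2 >= m]. *)
have : f 0%N ^+ 2 * m ^+ k <= A / b 0%N ^+ 2.
  apply: (IHk _ (fun i => b i.+1) (blaschke (b 0%N) f)) => [i j /binj[]//|//| |i].
    by move=> n; exact: sum_sqr_blaschke_le.
  have bi : b 0%N != b i.+1 by apply/eqP => /binj.
  rewrite (funext (fun n => quot_blaschke _ _ _ f n (lt0r_neq0 b0) bi)).
  set s := _ / _; set t := _ / _.
  have -> : 0 = s * 0 + t * 0 :> R by rewrite !mulr0 addr0.
  by apply: cvgD; (apply: cvgM; first exact: cvg_cst); exact: qf.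
rewrite ler_pdivlMr ?exprn_gt0//; apply: le_trans.
have fm : 0 <= f 0%N ^+ 2 * m ^+ k.
  by rewrite mulr_ge0 ?sqr_ge0// exprn_ge0// ltW// (lt_trans ltr01).
rewrite [m ^+ _]exprSr mulrA (ler_wpM2l fm)//.
by apply: le_trans (mb 0%N) _; rewrite expr2 ler_peMr// ltW.
Qed.

Lemma coef0_eq0 (R : realType) (m A : R) (b f : nat -> R) :
  1 < m -> injective b -> (forall i, m <= b i) ->
  (forall n, \sum_(i < n) f i ^+ 2 <= A) ->
  (forall i, quot (b i) f @ \oo --> (0 : R)) ->
  f 0%N = 0.
Proof.
move=> m1 binj mb fA qf; apply/eqP; rewrite -sqrf_eq0; apply/negPn/negP => f0.
have {}f0 : 0 < f 0%N ^+ 2 by rewrite lt_def f0 sqr_ge0.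
have mk k : m ^+ k <= A / f 0%N ^+ 2.
  by rewrite ler_pdivlMr// mulrC; exact: (@coef0_bound _ m A b f).
have bern k : 1 + k%:R * (m - 1) <= m ^+ k.
  elim: k => [|k IHk]; first by rewrite expr0; lra.
  have k0 : 0 <= k%:R * (m - 1) ^+ 2 by rewrite mulr_ge0// sqr_ge0.
  have := ler_wpM2l (ltW (lt_trans ltr01 m1)) IHk.
  by rewrite -exprS -natr1; nra.
set C := A / f 0%N ^+ 2 in mk.
have C0 : 0 <= C by have := mk 0%N; rewrite expr0; lra.
have m0 : 0 < m - 1 by lra.
have := Num.Theory.archi_boundP (divr_ge0 C0 (ltW m0)).
rewrite ltr_pdivrMr// => h.
by have := le_trans (bern _) (mk (Num.bound (C / (m - 1)))); lra.
Qed.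

Section Orbit.
Variables (R : realType) (beta : R).
Local Notation orbit n := (iter n (neg_beta_map beta) 1).

(** This is the recursion of [quot]: the orbit of 1 gives the coefficients of the digit series
    divided by [1 + beta z]. *)
Lemma orbitS n :
  orbit n.+1 = (neg_beta_expansion beta 1 n)%:~R - beta * orbit n.
Proof. by rewrite iterS /neg_beta_map /neg_beta_expansion intrD; ring. Qed.

Lemma orbit_itv n : 0 < orbit n <= 1.
Proof.
case: n => [|n]; first by rewrite ltr01 lexx.
by rewrite iterS; have := neg_beta_map_itv beta (orbit n); rewrite in_itv.
Qed.

Lemma simple_of_return p : 1 < beta -> orbit p.+1 = 1 -> simple_neg_beta beta.
Proof.
move=> b1 ret; split=> //; exists p.+1 => // n; rewrite /neg_beta_expansion.
suff -> : orbit n = orbit (n %% p.+1) by [].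
rewrite {1}(divn_eq n p.+1) addnC iterD; congr (iter _ _ _).
by elim: (n %/ _)%N => // k IHk; rewrite mulSn iterD IHk ret.
Qed.

(** The map takes the value 1 exactly where [beta * x] is an integer, so the orbit returns to its
    start. *)
Lemma simple_of_int n (k : int) :
  1 < beta -> beta * orbit n = k%:~R -> simple_neg_beta beta.
Proof.
move=> b1 e; apply: (@simple_of_return n) => //.
by rewrite iterS /neg_beta_map mulNr e intrKfloor addNr add0r.
Qed.

End Orbit.

Section NoSimple.
Variables (R : realType) (l u : R).
Hypotheses (l1 : 1 < l) (lu : l < u).
Hypothesis nosimple : forall beta, l < beta < u -> ~ simple_neg_beta beta.

(** If the floor dropped from [k] to a smaller value, ['X * p - k] would have a root in between,
    hence a simple number. One inequality suffices, by symmetry. *)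
Lemma floor_const (p : {poly R}) n :
  (forall beta, l < beta < u -> iter n (neg_beta_map beta) 1 = p.[beta]) ->
  forall beta gamma, l < beta < u -> l < gamma < u ->
    Num.floor (beta * p.[beta]) <= Num.floor (gamma * p.[gamma]).
Proof.
move=> hp beta gamma hb hg; rewrite leNgt; apply/negP => lt.
set k := Num.floor (beta * p.[beta]) in lt.
have kb : k%:~R <= beta * p.[beta] by exact: floor_le_tmp.
have kg : gamma * p.[gamma] <= k%:~R.
  by rewrite ltW// -floor_lt_int.
pose q := 'X * p - (k%:~R)%:P.
have qE x : q.[x] = x * p.[x] - k%:~R by rewrite /q !hornerE.
have [x /andP[lx xu]] : exists2 x, l < x < u & root q x.
  have [bg|/ltW gb] := leP beta gamma.
    have [|x] := @poly_ivt _ (- q) beta gamma bg.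
      by rewrite !hornerN !qE; lra.
    rewrite rootN => hx rx; exists x => //; lra.
  have [|x] := @poly_ivt _ q gamma beta gb.
    by rewrite !qE; lra.
  move=> hx rx; exists x => //; lra.
rewrite /root qE subr_eq0 => /eqP e.
have hx : l < x < u by rewrite lx.
by apply: (nosimple _ hx); apply: (@simple_of_int _ _ n k); [move: l1; lra|rewrite hp].
Qed.

(** Polynomiality supplies the continuity behind [floor_const], which in turn makes the next digit
    constant; the midpoint [c] is an arbitrary sample. *)
Lemma orbit_poly n : exists p : {poly R},
  forall beta, l < beta < u -> iter n (neg_beta_map beta) 1 = p.[beta].
Proof.
elim: n => [|n [p hp]]; first by exists 1 => b _; rewrite hornerE.
pose c := (l + u) / 2.
have hc : l < c < u by rewrite /c; move: lu; lra.
exists ((Num.floor (c * p.[c]) + 1)%:~R%:P - 'X * p) => b hb.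
rewrite orbitS /neg_beta_expansion hp// !hornerE; congr (_%:~R - _).
by congr (_ + 1); apply/eqP; rewrite eq_le !(@floor_const p n).
Qed.

Lemma digit_const beta gamma n : l < beta < u -> l < gamma < u ->
  neg_beta_expansion beta 1 n = neg_beta_expansion gamma 1 n.
Proof.
move=> hb hg; have [p hp] := orbit_poly n.
rewrite /neg_beta_expansion !hp//; congr (_ + 1).
by apply/eqP; rewrite eq_le !(@floor_const p n).
Qed.

Lemma nosimple_absurd : False.
Proof.
have [l1' lu'] := (l1, lu).
pose c i : R := l + (u - l) / i.+2%:R.
have hc i : l < c i < u.
  rewrite /c ltrDl divr_gt0 ?subr_gt0//=.
  by rewrite -ltrBrDl ltr_pdivrMr// ltr_pMr ?subr_gt0// ltr1n.
have cinj : injective c.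
  move=> i j /addrI /(mulfI _) h.
  have /invr_inj /eqP : i.+2%:R^-1 = j.+2%:R^-1 :> R by apply: h; lra.
  by rewrite eqr_nat => /eqP[].
(* Rescaling by [rho < 1] makes bounded coefficients square summable, while
   [rho * l = (l + 1) / 2 > 1] keeps the zeros uniformly inside the unit disc. *)
pose rho := (l + 1) / (2 * l).
have l0 : 0 < l by lra.
have rhol : rho * l = (l + 1) / 2 by rewrite /rho; field; lra.
have rho0 : 0 < rho by rewrite /rho divr_gt0//; lra.
have rho1 : rho < 1 by nra.
pose d n : R := (neg_beta_expansion (c 0%N) 1 n)%:~R.
pose f n := if n is n'.+1 then d n' * rho ^+ n else 1.
have quotE i n : quot (c i * rho) f n = iter n (neg_beta_map (c i)) 1 * rho ^+ n.
  elim: n => [|n IHn]; first by rewrite /= mulr1.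
  rewrite [LHS]/= IHn orbitS (@digit_const _ (c 0%N))// -/(d n) exprS; ring.
have d_bound n : `|d n| <= u + 1.
  have := orbitS _ (c 0%N) n; rewrite -/(d n) => e.
  have /andP[] := orbit_itv _ (c 0%N) n.
  have /andP[] := orbit_itv _ (c 0%N) n.+1.
  have /andP[] := hc 0%N.
  move: e; set x := iter _ _ _; set y := iter _ _ _ => e lc cu x0 x1 y0 y1.
  by rewrite ler_norml; apply/andP; split; nra.
have f_bound n : f n ^+ 2 <= (u + 1) ^+ 2 * (rho ^+ 2) ^+ n.
  case: n => [|n]; first by rewrite /f expr1n expr0 mulr1; nra.
  rewrite /f exprMn exprAC ler_wpM2r//; first exact: sqr_ge0.
  by rewrite -[d n ^+ 2]real_normK ?num_real// lerXn2r ?nnegrE//; lra.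
have rho2 : rho ^+ 2 < 1 by nra.
suff : f 0%N = 0 by move/eqP; rewrite oner_eq0.
apply: (@coef0_eq0 R (rho * l) ((u + 1) ^+ 2 / (1 - rho ^+ 2)) (fun i => c i * rho)).
- by rewrite rhol; lra.
- by move=> i j /(mulIf (lt0r_neq0 rho0)) /cinj.
- by move=> i; rewrite mulrC ler_pM2r//; have /andP[/ltW] := hc i.
- move=> n; apply: (@le_trans _ _ (\sum_(i < n) (u + 1) ^+ 2 * (rho ^+ 2) ^+ i)).
    by apply: ler_sum => i _; exact: f_bound.
  rewrite -mulr_sumr ler_wpM2l ?sqr_ge0// -div1r ler_pdivlMr; last by lra.
  rewrite mulrC -opprB mulNr -subrX1 opprB gerBl.
  by rewrite exprn_ge0// sqr_ge0.
- move=> i; rewrite (funext (quotE i)).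
  apply: (@squeeze_cvgr _ _ _ _ (fun=> 0) (fun n => rho ^+ n)).
  + near=> n; have /andP[x0 x1] := orbit_itv _ (c i) n.
    have rn : 0 <= rho ^+ n by rewrite exprn_ge0// ltW.
    by rewrite (mulr_ge0 (ltW x0) rn) ler_piMl.
  + exact: cvg_cst.
  + by apply: cvg_expr; rewrite gtr0_norm.
Unshelve. all: by end_near. Qed.

End NoSimple.

Theorem theorem1p6 (R : realType) :
  `]1, +oo[ `<=` closure (@simple_neg_beta R).
Proof.
move=> x; rewrite /= in_itv /= andbT => x1 B /nbhs_ballP[e /= e0 xB].
apply: contrapT => none.
(* Only the right half of the ball is used, so that the left endpoint [x] exceeds 1. *)
apply: (@nosimple_absurd R x (x + e)) => //; first by rewrite ltrDl.
move=> beta /andP[xb be] sb; apply: none; exists beta; split=> //.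
by apply: xB; rewrite /ball /= ltr_distlC; lra.
Qed.
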